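(* Let $h\ge2$ and $r:=h+1$. For a $2$-uniform hypergraph $\mathcal G$ on $[4]=\{1,2,3,4\}$, that is, a graph with possibly parallel edges, let $H_{\mathcal G}$ be its dual hypergraph: its vertices are the edges of $\mathcal G$, and its edges are $e_i:=\{\text{edges of }\mathcal G\text{ incident with }i\}$ for $i\in[4]$. (a) The $r$-uniform hypergraphs with four edges in which every vertex lies in exactly two edges and deleting any one edge leaves a connected spanning hypergraph are, up to isomorphism, exactly the $H_{\mathcal G}$ with $\mathcal G$ $r$-regular and $\mathcal G-i$ connected for every $i\in[4]$. (b) Such a $\mathcal G$ exists for every $h\ge2$. Hence for every $h\ge2$ and every prime power $q$ there is a QMDS $[4,(2h+1)/h,2]_q^h$ code $\mathcal C_{H_{\mathcal G}}$.
   Context: A finite hypergraph is a triple $H=(V,\mathcal E,\psi_H)$ with finite sets $V$, $\mathcal E$ and a map $\psi_H:\mathcal E\to2^V\setminus\{\emptyset\}$ (distinct edges may have the same vertex set; $e$ is identified with $\psi_H(e)$). It is $r$-uniform if $|e|=r$ for all edges. Vertices are in the same component if joined by a walk $u_0,e_1,u_1,\ldots,e_\ell,u_\ell$ with $u_{i-1},u_i\in e_i$; connected means one component. ''Deleting $e$ leaves a connected spanning hypergraph'' means that $(V,\mathcal E\setminus\{e\},\psi_H|_{\mathcal E\setminus\{e\}})$, on all of $V$, is connected. For a graph $\mathcal G$ and a vertex $i$, $\mathcal G-i$ is the graph obtained by deleting $i$ and the edges incident with it; $\mathcal G$ is $r$-regular if every vertex is in exactly $r$ edges (parallel edges counted with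 multiplicity). Code of an $r$-uniform hypergraph $H$: with $h=r-1$, fix for each edge an ordering $e=(v_{e,1},\ldots,v_{e,r})$ and an $\mathbb F_q$-linear bijection $\iota:\mathbb F_q^h\to\mathbb F_{q^h}$. For $a:V\to\mathbb F_q$ let $\Phi_H(a):=\bigl(\iota\bigl((a(v_{e,j})-a(v_{e,1}))_{2\le j\le r}\bigr)\bigr)_{e\in\mathcal E}\in\mathbb F_{q^h}^{|\mathcal E|}$, and $\mathcal C_H:=\operatorname{Im}(\Phi_H)$. An $[n,k/h,d]_q^h$ code is a $k$-dimensional $\mathbb F_q$-subspace of $\mathbb F_{q^h}^n$ whose nonzero elements have minimum Hamming weight $d$. It is QMDS if it attains the Singleton bound, i.e. $d=n-\lceil k/h\rceil+1$. *)

(* Defs.v *)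
From HB Require Import structures.
From mathcomp Require Import all_boot all_order all_algebra all_field.

Set Implicit Arguments.
Unset Strict Implicit.
Unset Printing Implicit Defensive.

Import GRing.Theory.
Local Open Scope ring_scope.

(* Distinct elements of E may be mapped to the same vertex set, so parallel
   edges are allowed. *)
Record hypergraph (V E : finType) := Hypergraph {
  edge_set :> E -> {set V};
  edge_set_neq0 : forall e, edge_set e != set0 }.

Section Hypergraphs.
Variables V E : finType.
Implicit Type H : hypergraph V E.

Definition uniform H (r : nat) : Prop := forall e, #|H e| = r.

Definition incident_edges H (x : V) : {set E} := [set e | x \in H e].

Definition regular H (r : nat) : Prop := forall x, #|incident_edges H x| = r.

Definition share_edge H : rel V :=
  fun x y => [exists e, (x \in H e) && (y \in H e)].

(* A walk is a share_edge-path, so [connect] is the relation of being in the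
   same component.  Without vertices there are zero components, not one. *)
Definition connected H : Prop :=
  (0 < #|V|)%N /\ forall x y, connect (share_edge H) x y.

Definition delete_edge H (e : E) : hypergraph V {f : E | f != e} :=
  @Hypergraph V {f : E | f != e} (fun f => H (val f))
    (fun f => edge_set_neq0 H (val f)).

Lemma delete_vertex_neq0 H (x : V) (e : {e : E | x \notin H e}) :
  [set y : {y : V | y != x} | val y \in H (val e)] != set0.
Proof.
case: e => e /= xe; have [y ye] := set0Pn _ (edge_set_neq0 H e).
have yx : y != x by apply: contraNneq xe => <-.
by apply/set0Pn; exists (exist _ y yx); rewrite inE.
Qed.

Definition delete_vertex H (x : V) :
    hypergraph {y : V | y != x} {e : E | x \notin H e} :=
  Hypergraph (@delete_vertex_neq0 H x).

(* The dual has an edge for each vertex of H, and edges must be nonempty. *)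
Definition no_isolated H : Prop := forall x, incident_edges H x != set0.

Definition dual H (H_ni : no_isolated H) : hypergraph E V := Hypergraph H_ni.

Lemma regular_no_isolated H (r : nat) : regular H r.+1 -> no_isolated H.
Proof. by move=> H_reg x; rewrite -card_gt0 H_reg. Qed.

End Hypergraphs.

Definition isomorphic (V E V' E' : finType)
    (H : hypergraph V E) (H' : hypergraph V' E') : Prop :=
  exists (f : V -> V') (g : E -> E'),
    [/\ bijective f, bijective g & forall e, H' (g e) = f @: H e].

(* v e lists each vertex of the edge e exactly once. *)
Definition edge_ordering (V E : finType) (r : nat) (H : hypergraph V E)
    (v : E -> r.-tuple V) : Prop :=
  forall e, uniq (v e) /\ v e =i H e.

Section HypergraphCode.
Variables (F : finFieldType) (L : fieldExtType F) (h : nat) (V E : finType).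
Variables (v : E -> h.+1.-tuple V) (iota : {linear 'rV[F]_h -> L}).

(* F^o is F seen as a vector space over itself. *)
Definition hcode_map (a : {ffun V -> F^o}) : {ffun E -> L} :=
  [ffun e => iota
    (\row_(j < h) (a (tnth (v e) (lift ord0 j)) - a (tnth (v e) ord0) : F))].

Lemma hcode_map_linear : linear hcode_map.
Proof.
move=> c a b; apply/ffunP => e; rewrite !ffunE -linearP; congr (iota _).
by apply/rowP => j; rewrite !mxE !ffunE mulrBr opprD addrACA.
Qed.

HB.instance Definition _ :=
  GRing.isLinear.Build F {ffun V -> F^o} {ffun E -> L} _ hcode_map
    hcode_map_linear.

(* The hypergraph enters only through the orderings of its edges. *)
Definition hcode : {vspace {ffun E -> L}} := limg (linfun hcode_map).

Lemma hcodeP x : reflect (exists a, x = hcode_map a) (x \in hcode).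
Proof.
apply: (iffP memv_imgP) => [[a _ ->]|[a ->]].
  by exists a; rewrite lfunE.
by exists a; rewrite ?memvf // lfunE.
Qed.

End HypergraphCode.

Section Codes.
Variables (F : finFieldType) (L : fieldExtType F) (I : finType).
Implicit Type C : {vspace {ffun I -> L}}.

Definition hamming_weight (x : {ffun I -> L}) : nat := #|[set i | x i != 0]|.

Definition min_weight C (d : nat) : Prop :=
  (exists x, [/\ x \in C, x != 0 & hamming_weight x = d]) /\
  (forall x, x \in C -> x != 0 -> (d <= hamming_weight x)%N).

(* C is an [n, k/h, d]_q^h code, with F = F_q and L = F_{q^h}. *)
Definition is_code (q h n k d : nat) C : Prop :=
  [/\ #|F| = q, \dim {:L} = h, #|I| = n, \dim C = k & min_weight C d].

Definition is_QMDS_code (q h n k d : nat) C : Prop :=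
  is_code q h n k d C /\
  d%:Z = n%:Z - Num.ceil (k%:R / h%:R : rat) + 1.

End Codes.

Definition prime_power (q : nat) : Prop :=
  exists p m : nat, [/\ prime p, (0 < m)%N & q = (p ^ m)%N].

(* Main.v *)
Require Import Defs.
From mathcomp Require Import all_boot all_order all_algebra all_field.

(* (a) Vertices of degree 2 are the edges of the dual graph.  If two edges f,
   f' other than e share a vertex, then that vertex is not in e, so it is an
   edge of the dual graph avoiding e; hence walks avoiding the edge e in H
   correspond to walks avoiding the vertex e in the dual graph.
   (b) A word of the code vanishes at e exactly when a is constant on e.  As H
   is connected, the kernel of the encoding consists of the constants, so the
   dimension is |V| - 1 = 2h + 1; as H minus any edge is connected, a nonzero
   word has weight at least 2, and the indicator of a vertex attains this. *)

Set Implicit Arguments.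
Unset Strict Implicit.
Unset Printing Implicit Defensive.

(** [P] is [Prop]-valued so that it can be a statement quantifying over the vertices of another
    hypergraph. *)
Lemma connect_invariant (T : finType) (r : rel T) (P : T -> Prop) :
  (forall x y, r x y -> P x -> P y) -> forall x y, connect r x y -> P x -> P y.
Proof.
move=> rP x y /connectP[p + ->] {y}.
by elim: p x => //= z p IHp x /andP[/rP xz /IHp pP] /xz.
Qed.

(** * Hypergraphs in which every vertex has degree two *)

Section TwoRegular.
Variables (V E : finType) (H : hypergraph V E).
Hypothesis H_reg : regular H 2.

(** Of the two edges through [x], removing [e] leaves at least one, whether or not [e] contains
    [x]. *)
Lemma regular2_edge_neq (x : V) (e : E) :
  exists2 f, f != e & x \in H f.
Proof.
have /card_gt0P[f] : 0 < #|incident_edges H x :\ e|.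
  rewrite -(ltn_add2l (e \in incident_edges H x)) -cardsD1 H_reg addn0.
  by case: (_ \in _).
by rewrite !inE => /andP[]; exists f.
Qed.

Lemma regular2_edge_eq (x : V) (e e1 e2 : E) :
  e1 != e -> e2 != e -> x \in H e -> x \in H e1 -> x \in H e2 -> e1 = e2.
Proof.
move=> e1e e2e xe xe1 xe2.
have le1 : #|incident_edges H x :\ e| <= 1.
  by have := cardsD1 e (incident_edges H x);
  rewrite H_reg inE xe add1n => -[<-].
by apply: (card_le1_eqP le1); rewrite !inE ?e1e ?e2e.
Qed.

End TwoRegular.

(** * Edge deletion against vertex deletion in the dual *)

Section Duality.
Variables (V E V' E' : finType) (H : hypergraph V E) (G : hypergraph V' E').
Variables (f : V -> E') (g : E -> V').
Hypotheses (f_bij : bijective f) (g_bij : bijective g).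
(** Up to the two bijections this says that [H] is the dual of [G], without forming that dual. *)
Hypothesis incE : forall x e, (g e \in G (f x)) = (x \in H e).

Lemma regular_of_uniform_dual (r : nat) : uniform G r -> regular H r.
Proof.
have [g' gK g'K] := g_bij; move=> G_unif x; rewrite -(G_unif (f x)).
rewrite -(card_imset _ (bij_inj g_bij)); apply: eq_card => i.
by rewrite -[i]g'K (mem_imset _ _ (bij_inj g_bij)) inE incE.
Qed.

Hypothesis H_reg : regular H 2.

(** Each direction carries an invariant along a walk; the edges of [H] other than [e] serve as the
    vertices of [G] other than [g e]. *)
Lemma connected_delete_dual (e : E) :
  connected (delete_edge H e) <-> connected (delete_vertex G (g e)).
Proof.
have [f' fK f'K] := f_bij; have [g' gK g'K] := g_bij.
have g'e (u : {y : V' | y != g e}) : g' (val u) != e.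
  by case: u => u /= uP; apply: contra_neq uP => <-; rewrite g'K.
have ge d : d != e -> g d != g e by rewrite (inj_eq (bij_inj g_bij)).
split=> -[/card_gt0P[z _] conn]; split.
- have [d /ge dP _] := regular2_edge_neq H_reg z e.
  by apply/card_gt0P; exists (exist _ (g d) dP).
- have step x (u w : {y : V' | y != g e}) : x \in H (g' (val u)) ->
      x \in H (g' (val w)) -> connect (share_edge (delete_vertex G (g e))) u w.
    (* If [x] lies in [e], degree two leaves it one further edge, so [u] and [w] coincide; otherwise
       the edge [f x] survives the deletion of [g e] and joins them. *)
    move=> xu xw; have [xe|xe] := boolP (x \in H e).
      suff -> : u = w by apply: connect0.
      apply: val_inj; apply: (can_inj g'K).
      exact: regular2_edge_eq xe xu xw.
    have fxP : g e \notin G (f x) by rewrite incE.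
    apply: connect1; apply/existsP; exists (exist _ (f x) fxP).
    by rewrite !inE /= -[val u]g'K -[val w]g'K !incE xu.
  move=> u w; have [x xu] := set0Pn _ (edge_set_neq0 H (g' (val u))).
  have [y yw] := set0Pn _ (edge_set_neq0 H (g' (val w))).
  (* The invariant covers all remaining edges through [y], since a walk may leave [y] by any of
     them. *)
  pose P y := forall w : {y : V' | y != g e}, y \in H (g' (val w)) ->
    connect (share_edge (delete_vertex G (g e))) u w.
  suff /(_ _ _ (conn x y)) Pxy : forall s t : V,
      connect (share_edge (delete_edge H e)) s t -> P s -> P t.
    by apply: Pxy yw => {}w; apply: step.
  apply: connect_invariant => {w xu yw}x {}y /existsP[[d dP] /= /andP[xd yd]].
  move=> Px w yw.
  apply: connect_trans (Px (exist _ (g d) (ge d dP)) _) _.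
    by rewrite /= gK.
  by apply: step yw; rewrite /= gK.
- have [x _] := set0Pn _ (edge_set_neq0 H (g' (val z))).
  by apply/card_gt0P; exists x.
- move=> x y; have [d /ge dP xd] := regular2_edge_neq H_reg x e.
  have [d1 /ge d1P yd1] := regular2_edge_neq H_reg y e.
  have step (u : {y : V' | y != g e}) s t :
      s \in H (g' (val u)) -> t \in H (g' (val u)) ->
      connect (share_edge (delete_edge H e)) s t.
    move=> su tu;
    apply: connect1; apply/existsP; exists (exist _ (g' (val u)) (g'e u)).
    by rewrite /= su.
  pose P (u : {y : V' | y != g e}) :=
    forall y, y \in H (g' (val u)) ->
    connect (share_edge (delete_edge H e)) x y.
  have Pd : P (exist _ (g d) dP) by move=> t; apply: step; rewrite /= gK.
  suff /(_ _ _ (conn _ _) Pd) Pd1 : forall s t : {y : V' | y != g e},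
      connect (share_edge (delete_vertex G (g e))) s t -> P s -> P t.
    by apply: (Pd1 (exist _ (g d1) d1P)); rewrite /= gK.
  apply: connect_invariant => u w /existsP[[a aP]];
  rewrite !inE /= => /andP[ua wa] Pu t tw.
  (* The edge [a] of [G], read as the vertex [f' a] of [H], is common to the edges [u] and [w]. *)
  apply: connect_trans (Pu (f' a) _) _; first by rewrite -incE g'K f'K.
  by apply: step tw; rewrite -incE g'K f'K.
Qed.

End Duality.

Lemma connected_of_delete (V E : finType) (H : hypergraph V E) (e : E) :
  connected (delete_edge H e) -> connected H.
Proof.
case=> V_gt0 conn; split=> // x y; apply: connect_sub (conn x y) => {}x {}y.
by case/existsP=> f xy; apply: connect1; apply/existsP; exists (val f).
Qed.

(** * Dimension and minimum weight of the code *)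

Section Code.
Import GRing.Theory.
Local Open Scope ring_scope.
Variables (F : finFieldType) (L : fieldExtType F) (h : nat) (V E : finType).
Variables (H : hypergraph V E) (v : E -> h.+1.-tuple V).
Variable iota : {linear 'rV[F]_h -> L}.
Hypotheses (vP : edge_ordering H v) (iota_bij : bijective iota).
Implicit Type a : {ffun V -> F^o}.

(** As [iota] is injective, the coordinate vanishes iff every difference with the head of the
    ordering does, and the ordering exhausts [e]. *)
Lemma hcode_map_eq0 a e : hcode_map v iota a e = 0 <->
  {in H e &, forall x y, a x = a y}.
Proof.
have [_ ve] := vP e; rewrite ffunE; split=> [|a_const]; last first.
  rewrite -(linear0 iota); congr (iota _); apply/rowP => j; rewrite !mxE.
  by rewrite (a_const _ (tnth (v e) ord0)) ?subrr // -ve mem_tnth.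
rewrite -(linear0 iota) => /(bij_inj iota_bij)/rowP a0.
suff a_head x : x \in H e -> a x = a (tnth (v e) ord0).
  by move=> x y /a_head-> /a_head->.
rewrite -ve => /tnthP[j ->]; have [j' ->|->//] := unliftP ord0 j.
by apply/eqP; rewrite -subr_eq0; have := a0 j'; rewrite !mxE => ->.
Qed.

(** Stated for any hypergraph on [V]: the kernel computation applies it to [H], the weight bound to
    [H] minus an edge. *)
Lemma connected_const (E' : finType) (H' : hypergraph V E') a :
    connected H' -> (forall e, {in H' e &, forall x y, a x = a y}) ->
  forall x y, a x = a y.
Proof.
move=> [_ conn] a_const x y.
apply: (connect_invariant (P := fun y => a x = a y)) (conn x y) _ => //.
by move=> {}y z /existsP[e /andP[ye ze]] ->; apply: a_const ye ze.
Qed.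

(** Rank-nullity, the kernel being the line of constant functions; a vertex [x0] ensures that [one]
    is nonzero. *)
Lemma dim_hcode : connected H -> (\dim (hcode v iota)).+1 = #|V|.
Proof.
move=> H_conn; have [/card_gt0P[x0 _] _] := H_conn.
pose one : {ffun V -> F^o} := [ffun=> 1].
have one_neq0 : one != 0.
  by apply/eqP => /ffunP/(_ x0)/eqP; rewrite !ffunE oner_eq0.
have ker1 : lker (linfun (hcode_map v iota)) = <[one]>%VS.
  apply/vspaceP => a; rewrite memv_ker lfunE /=.
  apply/eqP/vlineP => [a0|[c ->]].
    exists (a x0); apply/ffunP => x; rewrite !ffunE [RHS]mulr1.
    apply: (connected_const H_conn) => e; apply/hcode_map_eq0.
    by rewrite a0 ffunE.
  apply/ffunP => e; rewrite [RHS]ffunE; apply/hcode_map_eq0 => x y _ _.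
  by rewrite !ffunE.
have := limg_ker_dim (linfun (hcode_map v iota)) fullv.
rewrite capfv ker1 dim_vline one_neq0 add1n dimvf => ->.
by rewrite /dim /= muln1.
Qed.

(** If [e] were the only edge in the support, [a] would be constant on all other edges, hence on [V]
    by connectedness without [e], and the word would vanish at [e] too. *)
Lemma hcode_weight_ge2 (x : {ffun E -> L}) :
    (forall e, connected (delete_edge H e)) ->
  x \in hcode v iota -> x != 0 -> (2 <= hamming_weight x)%N.
Proof.
move=> conn /hcodeP[a ->{x}] a_neq0; rewrite ltnNge; apply/negP => le1.
have [e ae|a0] := pickP [pred e | hcode_map v iota a e != 0]; last first.
  case/eqP: a_neq0; apply/ffunP => e; rewrite [RHS]ffunE.
  exact/eqP/negbFE/a0.
have a_const : forall y z, a y = a z.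
  apply: (connected_const (conn e)) => -[d de] /=; apply/hcode_map_eq0.
  apply/eqP; apply: contraTT de => ad; rewrite negbK; apply/eqP.
  by apply: (card_le1_eqP le1); rewrite inE.
by case/negP: ae; apply/eqP/hcode_map_eq0 => y z _ _.
Qed.

Lemma hcode_light_word (r : nat) : (0 < h)%N -> (0 < #|V|)%N ->
    uniform H h.+1 -> regular H r.+1 ->
  exists x, [/\ x \in hcode v iota, x != 0 & (hamming_weight x <= r.+1)%N].
Proof.
move=> h_gt0 /card_gt0P[x0 _] H_unif H_reg.
(* The word of this indicator is supported on the edges through x0. *)
pose a : {ffun V -> F^o} := [ffun x => (x == x0)%:R].
exists (hcode_map v iota a); split; first by apply/hcodeP; exists a.
  have /card_gt0P[e] : (0 < #|incident_edges H x0|)%N by rewrite H_reg.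
  rewrite inE => x0e; apply/eqP => /ffunP/(_ e); rewrite [RHS]ffunE.
  move=> /hcode_map_eq0.
  (* Since [h] is positive, [e] has a second vertex, where the indicator takes a different value. *)
  have /card_gt0P[y] : (0 < #|H e :\ x0|)%N.
    by have := cardsD1 x0 (H e); rewrite H_unif x0e add1n => -[<-].
  rewrite !inE => /andP[yx0 ye] /(_ y x0 ye x0e)/eqP.
  by rewrite !ffunE eqxx (negPf yx0) eq_sym oner_eq0.
rewrite -(H_reg x0); apply: subset_leq_card; apply/subsetP => e; rewrite !inE.
apply: contraNT => x0e; apply/eqP/hcode_map_eq0 => y z ye ze; rewrite !ffunE.
by rewrite (negPf (memPn x0e _ ye)) (negPf (memPn x0e _ ze)).
Qed.

Lemma hcode_QMDS : (0 < h)%N -> \dim {:L}%VS = h -> #|E| = 4 ->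
    #|V| = (2 * h.+1)%N -> uniform H h.+1 -> regular H 2 ->
    (forall e, connected (delete_edge H e)) ->
  is_QMDS_code #|F| h 4 (2 * h + 1) 2 (hcode v iota).
Proof.
move=> h_gt0 dimL E4 V2h H_unif H_reg conn.
have /card_gt0P[e _] : (0 < #|E|)%N by rewrite E4.
split; first split=> //.
- apply/eq_add_S; rewrite (dim_hcode (connected_of_delete (conn e))) V2h.
  by rewrite mulnS addn1.
- split=> [|x xC x0]; last exact: hcode_weight_ge2.
  have [|x [xC x0 x_le2]] := hcode_light_word h_gt0 _ H_unif H_reg.
    by rewrite V2h.
  exists x; split=> //; apply/eqP; rewrite eqn_leq x_le2.
  exact: hcode_weight_ge2.
(* The Singleton bound reads 4 - 3 + 1 = 2; the ceiling is 3 because 2h < 2h + 1 <= 3h. *)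
- suff -> : Num.ceil ((2 * h + 1)%:R / h%:R : rat) = 3 by [].
  have h0 : (0 < h%:R :> rat) by rewrite Num.Theory.ltr0n.
  apply: Num.Theory.ceil_def.
  rewrite Num.Theory.ltr_pdivlMr // Num.Theory.ler_pdivrMr //.
  rewrite -[(3 - 1)%:~R]/(2%:R) -[3%:~R]/(3%:R) -!natrM.
  rewrite Num.Theory.ltr_nat Num.Theory.ler_nat addn1 ltnSn /=.
  by rewrite ltn_mul2r h_gt0.
Qed.

End Code.

(* For each k the edges (k, true) and (k, false) form a perfect matching:
   {01, 23} if k = 0 and {03, 12} otherwise. *)
Section ThickCycle.
Variable h : nat.

Definition cycle4_end (k : bool) (i : 'I_4) : bool :=
  if k then 1 < i else (0 < i) && (i < 3).

Definition thick_cycle_edge (p : 'I_h.+1 * bool) : {set 'I_4} :=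
  [set i | cycle4_end (p.1 == ord0) i == p.2].

Lemma card_thick_cycle_edge p : #|thick_cycle_edge p| = 2.
Proof.
rewrite -sum1dep_card !big_mkcond /= !big_ord_recl big_ord0 /=.
by case: p => k []; rewrite /cycle4_end /=; case: (k == ord0).
Qed.

Lemma thick_cycle_neq0 p : thick_cycle_edge p != set0.
Proof. by rewrite -card_gt0 card_thick_cycle_edge. Qed.

(** The 4-cycle on 0, 1, 2, 3 with 01 and 23 simple and 12 and 03 of multiplicity [h]. *)
Definition thick_cycle := Hypergraph thick_cycle_neq0.

(** Each of the [h.+1] perfect matchings has exactly one edge at [i], namely [s k]. *)
Lemma thick_cycle_regular : regular thick_cycle h.+1.
Proof.
move=> i; pose s (k : 'I_h.+1) := (k, cycle4_end (k == ord0) i).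
have s_inj : injective s by move=> k l [].
rewrite -[RHS]card_ord -(card_codom s_inj); apply: eq_card => -[k b].
rewrite !inE /=; apply/eqP/codomP => [<-|[l [-> ->]] //]; by exists k.
Qed.

(** The vertex [m] opposite to [i] is adjacent to both other remaining vertices. It is [i + 2]
    modulo 4, separated from [i] by both matchings. *)
Lemma thick_cycle_delete (i : 'I_4) :
  0 < h -> connected (delete_vertex thick_cycle i).
Proof.
move=> h_gt0.
have /existsP[m /forallP m_opp] :
    [exists m : 'I_4, forall k, cycle4_end k m == ~~ cycle4_end k i].
  have [j jE] : exists j : 'I_4, nat_of_ord j = (i + 2) %% 4.
    by exists (Ordinal (ltn_pmod (i + 2) (isT : 0 < 4))).
  apply/existsP; exists j; apply/forallP => k; rewrite /cycle4_end jE.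
  by case: i jE => -[|[|[|[|]]]] //; case: k.
have m_i : m != i.
  by apply: contraTneq (m_opp true) => ->; case: (cycle4_end _ _).
pose w : {y : 'I_4 | y != i} := exist _ m m_i.
have edge_w u : share_edge (delete_vertex thick_cycle i) u w.
  (* Some matching separates [u] from [i]; its edge avoiding [i] then contains both [u] and [m]. *)
  have [k kP] : exists k, cycle4_end k (val u) != cycle4_end k i.
    case: u => -[u lt_u] /=; rewrite -val_eqE /= => ui.
    exists (cycle4_end true (Ordinal lt_u) != cycle4_end true i).
    case: i {m m_i m_opp w} ui => i lt_i /=.
    by case: u lt_u => [|[|[|[|]]]] //; case: i lt_i => [|[|[|[|]]]].
  (* An index realizing the matching [k]; [ord_max] differs from [ord0] because [h] is positive. *)
  pose l : 'I_h.+1 := if k then ord0 else ord_max.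
  have lE : (l == ord0) = k.
    by rewrite /l; case: (k); rewrite // -val_eqE /= gtn_eqF.
  have iP : i \notin thick_cycle (l, ~~ cycle4_end k i).
    by rewrite inE lE; case: (cycle4_end _ _).
  apply/existsP; exists (exist _ (l, ~~ cycle4_end k i) iP).
  rewrite !inE /= lE m_opp andbT.
  by move: kP; do 2!case: (cycle4_end _ _).
split=> [|x y]; first by apply/card_gt0P; exists w.
apply: connect_trans (connect1 (edge_w x)) _.
apply: connect1; have /existsP[e] := edge_w y; rewrite andbC => e_wy.
by apply/existsP; exists e.
Qed.

End ThickCycle.

(** * From isomorphism to incidence, and the classification with its example *)

Lemma isomorphic_incidence (V E V' E' : finType) (H : hypergraph V E)
    (H' : hypergraph V' E') (f : V -> V') (g : E -> E') :
    bijective f -> (forall e, H' (g e) = f @: H e) ->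
  forall x e, (f x \in H' (g e)) = (x \in H e).
Proof. by move=> /bij_inj f_inj HE x e; rewrite HE mem_imset. Qed.

Theorem proposition5p9 (h : nat) (h_ge2 : 2 <= h) :
  (* (a) *)
  (forall (V E : finType) (H : hypergraph V E),
     [/\ #|E| = 4, uniform H h.+1, regular H 2
       & forall e : E, connected (delete_edge H e)]
     <->
     exists (E' : finType) (G : hypergraph 'I_4 E')
            (G_reg : regular G h.+1),
       [/\ uniform G 2,
           (forall i : 'I_4, connected (delete_vertex G i))
         & isomorphic H (dual (regular_no_isolated G_reg))])
  /\
  (* (b) *)
  (exists (E' : finType) (G : hypergraph 'I_4 E') (G_reg : regular G h.+1),
     [/\ uniform G 2,
         (forall i : 'I_4, connected (delete_vertex G i))
       & forall q : nat, prime_power q ->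
         forall (F : finFieldType) (L : fieldExtType F),
           #|F| = q -> \dim {:L}%VS = h ->
         forall (v : 'I_4 -> h.+1.-tuple E') (iota : {linear 'rV[F]_h -> L}),
           edge_ordering (dual (regular_no_isolated G_reg)) v ->
           bijective iota ->
           is_QMDS_code q h 4 (2 * h + 1) 2 (hcode v iota)]).
Proof.
split=> [V E H|].
  split=> [[E4 H_unif H_reg H_conn]|].
    pose g e : 'I_4 := cast_ord E4 (enum_rank e).
    have g_bij : bijective g.
      exists (fun i => enum_val (cast_ord (esym E4) i)) => x.
        by rewrite cast_ordK enum_rankK.
      by rewrite /g enum_valK cast_ordKV.
    have g_inj := bij_inj g_bij; have [g' gK g'K] := g_bij.
    have G_card x : #|g @: incident_edges H x| = 2.
      by rewrite card_imset // H_reg.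
    have G_neq0 x : g @: incident_edges H x != set0 by rewrite -card_gt0 G_card.
    (* The edges of [H], numbered by [g], become vertices, and each vertex of [H] becomes the edge
       joining the two edges through it. *)
    pose G := Hypergraph G_neq0.
    have incE x e : (g e \in G x) = (x \in H e) by rewrite mem_imset // inE.
    have G_inc i : incident_edges G i = H (g' i).
      by apply/setP => x; rewrite inE -[i in LHS]g'K incE.
    have G_reg : regular G h.+1 by move=> i; rewrite G_inc H_unif.
    exists V, G, G_reg; split=> // [i|].
      rewrite -[i]g'K.
      by apply/(connected_delete_dual (f := id)); first exists id.
    exists id, g; split=> // [|e]; first by exists id.
    by rewrite /= G_inc gK imset_id.
  case=> E' [G] [G_reg] [G_unif G_conn] [f] [g] [f_bij g_bij HE].
  have incE x e : (g e \in G (f x)) = (x \in H e).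
    by rewrite -(isomorphic_incidence f_bij HE) inE.
  have H_reg := regular_of_uniform_dual g_bij incE G_unif.
  split=> // [|e|e]; first by rewrite (bij_eq_card g_bij) card_ord.
    (* The size of an edge [e] of [H] is the degree of [g e] in [G]. *)
    by rewrite -(card_imset _ (bij_inj f_bij)) -HE G_reg.
  by apply/(connected_delete_dual f_bij g_bij incE).
have h_gt0 := ltnW h_ge2; have G_reg := @thick_cycle_regular h.
exists _, (thick_cycle h), G_reg;
  split=> [p|i|q _ F L <- dimL v iota vP iota_bij].
- exact: card_thick_cycle_edge.
- exact: thick_cycle_delete.
have id_bij (T : Type) : bijective (@id T) by exists id.
have incE p i :
    (i \in thick_cycle h p) = (p \in dual (regular_no_isolated G_reg) i).
  by rewrite [RHS]inE.
have H_reg : regular (dual (regular_no_isolated G_reg)) 2.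
  apply: (regular_of_uniform_dual (f := id) (id_bij _) incE).
  exact: card_thick_cycle_edge.
apply: (hcode_QMDS vP iota_bij h_gt0 dimL _ _ _ H_reg _) => //.
- by rewrite card_ord.
- by rewrite card_prod card_ord card_bool mulnC.
- move=> i.
  apply/(connected_delete_dual (f := id) (g := id) (id_bij _) (id_bij _) incE)
    => //.
  exact: thick_cycle_delete.
Qed.
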